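(* Let $I_i=I\cap K[X\setminus\{x_i\}]$ for $i=1,\ldots,n$. If $I_i$ is normal for $i=1,\ldots,n$ and $$H_{\ell_1}\cap H_{\ell_2}\cap\cdots\cap H_{\ell_r}\cap\mathbb R_+^{n+1}\ne(0),$$ then $R[It]$ is normal.
   Context: Let $R=K[x_1,\ldots,x_n]$ be a polynomial ring over a field $K$, $X=\{x_1,\ldots,x_n\}$, and let $I\subset R$ be an ideal of height $g\ge 2$ minimally generated by a finite set $F=\{x^{v_1},\ldots,x^{v_q}\}$ of square-free monomials of degree at least two (where $x^a=x_1^{a_1}\cdots x_n^{a_n}$). Each variable $x_i$ divides at least one monomial of $F$. For $a\in\mathbb R^{n+1}$ let $H_a=\{\alpha\in\mathbb R^{n+1}\mid\langle\alpha,a\rangle=0\}$ and $H_a^+=\{\alpha\in\mathbb R^{n+1}\mid\langle\alpha,a\rangle\ge 0\}$; $\mathbb R_+$ is the set of non-negative reals. Let $\mathcal A'=\{e_1,\ldots,e_n,(v_1,1),\ldots,(v_q,1)\}\subset\mathbb R^{n+1}$, $e_i$ the unit vectors. The Rees cone $\mathbb R_+\mathcal A'$ (all non-negative linear combinations of $\mathcal A'$) has a unique irreducible representation (no halfspace may be omitted) $$\mathbb R_+\mathcal A'=H_{e_1}^+\cap\cdots\cap H_{e_{n+1}}^+\cap H_{a_1}^+\cap\cdots\cap H_{a_r}^+$$ with $a_k\in\mathbb Q^{n+1}$ and $\langle a_k,e_{n+1}\rangle=-1$ for all $k$. Let $d_k$ be the unique positive integer such that $\ell_k=d_ka_k$ has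 relatively prime integral entries, $k=1,\ldots,r$. $I_i$ is an ideal of $K[X\setminus\{x_i\}]$. An ideal $J$ is normal if $J^k=\overline{J^k}$ (integral closure) for all $k\ge 1$. The Rees algebra is $R[It]=R\oplus It\oplus I^2t^2\oplus\cdots\subset R[t]$; it is normal if it is integrally closed in its field of fractions. *)

(* Defs.v *)
From HB Require Import structures.
From mathcomp Require Import all_boot all_order all_algebra.
From mathcomp Require Import ring_quotient fraction.
From mathcomp Require Import boolp classical_sets reals.
From mathcomp Require Import mpoly.

Set Implicit Arguments.
Unset Strict Implicit.
Unset Printing Implicit Defensive.

Import Order.TTheory GRing.Theory Num.Theory.

Local Open Scope classical_set_scope.
Local Open Scope ring_scope.

(** * Ideals of a commutative ring, as sets *)

Definition ideal_gen (A : comNzRingType) (G : set A) : set A :=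
  [set x | exists (m : nat) (c y : 'I_m -> A),
     (forall i, G (y i)) /\ x = \sum_(i < m) c i * y i].

Definition minimally_generated_by (A : comNzRingType) (J G : set A) : Prop :=
  J = ideal_gen G /\ forall G' : set A, G' `<` G -> ideal_gen G' <> J.

(* For k = 0 the only product is 1, so that J^0 is the unit ideal. *)
Definition ideal_pow (A : comNzRingType) (J : set A) (k : nat) : set A :=
  ideal_gen [set x | exists2 y : 'I_k -> A,
     (forall i, J (y i)) & x = \prod_(i < k) y i].

Definition integral_closure (A : comNzRingType) (J : set A) : set A :=
  [set z | exists (m : nat) (a : nat -> A),
     [/\ (0 < m)%N,
         forall i, (1 <= i <= m)%N -> ideal_pow J i (a i) &
         z ^+ m + \sum_(1 <= i < m.+1) a i * z ^+ (m - i) = 0]].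

Definition normal_ideal (A : comNzRingType) (J : set A) : Prop :=
  forall k : nat, (0 < k)%N -> ideal_pow J k = integral_closure (ideal_pow J k).

(* [idealr_closed] includes properness. *)
Definition prime_ideal (A : comNzRingType) (P : set A) : Prop :=
  idealr_closed (mem P) /\ prime_idealr_closed (mem P).

Definition prime_chain (A : comNzRingType) (h : nat) (Q : nat -> set A) : Prop :=
  (forall i, (i <= h)%N -> prime_ideal (Q i)) /\
  (forall i, (i < h)%N -> Q i `<` Q i.+1).

Definition prime_height (A : comNzRingType) (P : set A) (h : nat) : Prop :=
  (exists2 Q, prime_chain h Q & Q h = P) /\
  (forall h' Q, prime_chain h' Q -> Q h' = P -> (h' <= h)%N).

(* Primes containing J for which no h satisfies [prime_height P h] have infinite
   height, hence do not affect the minimum. *)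
Definition ideal_height (A : comNzRingType) (J : set A) (g : nat) : Prop :=
  (exists P, [/\ prime_ideal P, J `<=` P & prime_height P g]) /\
  (forall P h, prime_ideal P -> J `<=` P -> prime_height P h -> (g <= h)%N).

(** * Normality of a subring S of a domain A

  The field of fractions of S is realized inside that of A. *)

Definition fractions_of (A : idomainType) (S : set A) : set {fraction A} :=
  [set z | exists x y : A,
     [/\ S x, S y, y != 0 & z = tofrac x / tofrac y]].

Definition integral_over (A : idomainType) (S : set A) (z : {fraction A}) :
    Prop :=
  exists p : {poly A},
    [/\ p \is monic, forall i, S p`_i & root (map_poly (@tofrac A) p) z].

Definition normal_domain (A : idomainType) (S : set A) : Prop :=
  forall z : {fraction A}, fractions_of S z -> integral_over S z ->
  exists2 s, S s & z = tofrac s.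

(* R[It] as a subset of R[t]; the indeterminate t is ['X]. *)
Definition rees_algebra (A : comNzRingType) (J : set A) : set {poly A} :=
  [set p | forall k : nat, ideal_pow J k p`_k].

(** * Contraction to the polynomial ring without the i-th variable

  K[X \ {x_i}] is the polynomial ring in n - 1 variables, its j-th variable
  being [x_(lift i j)]; [drop_var_incl] is its inclusion into K[X]. *)

Definition drop_var_incl (K : fieldType) (n : nat) (i : 'I_n)
    (p : {mpoly K[n.-1]}) : {mpoly K[n]} :=
  p \mPo [tuple 'X_(lift i j) | j < n.-1].

Definition contract_var (K : fieldType) (n : nat) (i : 'I_n)
    (J : set {mpoly K[n]}) : set {mpoly K[n.-1]} :=
  drop_var_incl i @^-1` J.

(** * Cones and halfspaces *)

Definition dotv (F : pzRingType) (m : nat) (u w : 'rV[F]_m) : F :=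
  \sum_(i < m) u 0 i * w 0 i.

Definition hyperplane (R : realType) (m : nat) (a : 'rV[R]_m) : set 'rV[R]_m :=
  [set u | dotv u a = 0].

Definition halfspace (R : realType) (m : nat) (a : 'rV[R]_m) : set 'rV[R]_m :=
  [set u | 0 <= dotv u a].

Definition cone (R : realType) (m : nat) (B : set 'rV[R]_m) : set 'rV[R]_m :=
  [set u | exists (k : nat) (c : 'I_k -> R) (w : 'I_k -> 'rV[R]_m),
     (forall i, 0 <= c i /\ B (w i)) /\ u = \sum_(i < k) c i *: w i].

Definition orthant (R : realType) (m : nat) : set 'rV[R]_m :=
  [set u | forall i, 0 <= u 0 i].

Arguments orthant : clear implicits.

Definition irreducible_representation (R : realType) (m : nat) (T : Type)
    (C : set 'rV[R]_m) (a : T -> 'rV[R]_m) : Prop :=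
  C = \bigcap_(k in [set: T]) halfspace (a k) /\
  forall k0 : T, C <> \bigcap_(k in ~` [set k0]) halfspace (a k).

Definition rees_generators (R : realType) (n q : nat)
    (v : 'I_q -> 'X_{1..n}) : set 'rV[R]_(n + 1) :=
  [set u | (exists i : 'I_n, u = delta_mx 0 (lshift 1 i)) \/
           (exists j : 'I_q,
              u = row_mx (\row_(i < n) (v j i)%:R) (const_mx 1))].

Arguments rees_generators R {n q} v.

Definition rees_cone (R : realType) (n q : nat)
    (v : 'I_q -> 'X_{1..n}) : set 'rV[R]_(n + 1) :=
  cone (rees_generators R v).

Arguments rees_cone R {n q} v.

(* The normals e_1, ..., e_(n+1), a_1, ..., a_r. *)
Definition rees_normals (R : realType) (n r : nat)
    (a : 'I_r -> 'rV[rat]_(n + 1)) (k : 'I_(n + 1) + 'I_r) : 'rV[R]_(n + 1) :=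
  match k with
  | inl i => delta_mx 0 i
  | inr k => map_mx ratr (a k)
  end.

Arguments rees_normals R {n r} a.

Definition primitive_vec (m : nat) (l : 'rV[int]_m) : Prop :=
  \big[gcdn/0%N]_(i < m) `|l 0%R i|%N = 1%N.

(* Main.v *)
Require Import Defs.
From HB Require Import structures.
From mathcomp Require Import all_boot all_order all_algebra.
From mathcomp Require Import ring_quotient fraction.
From mathcomp Require Import boolp classical_sets reals.
From mathcomp Require Import mpoly.
From mathcomp Require Import zify ring lra.

Set Implicit Arguments.
Unset Strict Implicit.
Unset Printing Implicit Defensive.

Import Order.TTheory GRing.Theory Num.Theory.

Local Open Scope classical_set_scope.
Local Open Scope ring_scope.

(** Write [(b, c)] for the exponent of the monomial [x^b t^c].

    The proof rests on one combinatorial fact: every lattice point [(b, c)] of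
    the Rees cone is a sum of vectors [e_i] and [(v_j, 1)], in other words
    [x^b] lies in [I^c] ([rees_cone_exponent]).  A nonzero point of the orthant
    lying on all the hyperplanes [H_(l_k)] belongs to the cone, and the
    generators that occur in an expression of it lie on all these hyperplanes
    too.  They are not all unit vectors, by minimality of the square-free
    generators, so that some [(v_j0, 1)] lies on every [H_(l_k)]
    ([exists_generator_on_hyperplanes]).  Given a lattice point [(b, c)] of the
    cone with [c > 0], there are two cases.  If [x^(v_j0)] divides [x^b], the
    vector [(b, c) - (v_j0, 1)] is nonnegative and satisfies the same
    inequalities as [(b, c)], so it is in the cone and induction on [c] applies.
    Otherwise some variable [x_i] of [x^(v_j0)] is absent from [x^b].  A
    multiple of [(b, c)] is a sum of generators, none of which involves [x_i],
    whence [x^b] is integral over [I_i^c], and normality of [I_i] gives the claim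
    ([monomial_pow_of_contraction]).  Here an expression with real coefficients
    has to be replaced by one with rational coefficients
    ([rational_nonneg_solution]).

    It remains to pass from monomials to the whole Rees algebra [S].  An element
    [x / y] of the field of fractions which is integral over [S] is almost
    integral: there is [d <> 0] with [d (x / y)^k] in [S] for all [k]
    ([integral_common_denominator]).  Comparing leading exponents for a monomial
    order and letting [k] grow, the difference of the leading exponents of [x]
    and [y] satisfies all the inequalities of the cone
    ([rees_cone_saturated]), so it is the exponent of a monomial of [S].
    Subtracting a multiple of this monomial from [x / y] lowers the leading
    exponent of the numerator and preserves almost integrality; as monomial
    orders are well-founded, [x / y] lies in [S]
    ([division_almost_integral]). *)

(** * Powers of an ideal *)

Lemma ideal_gen_ind (A : comNzRingType) (G P : set A) :
  P 0 -> (forall x y, P x -> P y -> P (x + y)) ->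
  (forall c x, G x -> P (c * x)) -> ideal_gen G `<=` P.
Proof.
move=> P0 PD PG x [m [c [y [Gy ->]]]].
by elim/big_ind: _ => // i _; apply: PG.
Qed.

Lemma ideal_gen_mul (A : comNzRingType) (G : set A) c x :
  G x -> ideal_gen G (c * x).
Proof.
by move=> Gx; exists 1%N, (fun=> c), (fun=> x); split=> //; rewrite big_ord1.
Qed.

Lemma ideal_gen0 (A : comNzRingType) (G : set A) : ideal_gen G 0.
Proof.
by exists 0%N, (fun=> 0), (fun=> 0); split=> [[]//|]; rewrite big_ord0.
Qed.

Lemma ideal_genD (A : comNzRingType) (G : set A) x y :
  ideal_gen G x -> ideal_gen G y -> ideal_gen G (x + y).
Proof.
move=> [m [c [u [Gu ->]]]] [m' [c' [u' [Gu' ->]]]].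
pose glue (f : 'I_m -> A) (f' : 'I_m' -> A) (i : 'I_(m + m')) :=
  match split i with inl j => f j | inr j => f' j end.
have glueL f f' j : glue f f' (lshift m' j) = f j.
  by rewrite /glue (unsplitK (inl _ j)).
have glueR f f' j : glue f f' (rshift m j) = f' j.
  by rewrite /glue (unsplitK (inr _ j)).
exists (m + m')%N, (glue c c'), (glue u u'); split.
  by move=> i; rewrite /glue; case: (split i).
by rewrite big_split_ord; congr (_ + _); apply: eq_bigr => i _;
  rewrite ?glueL ?glueR.
Qed.

Lemma ideal_genM (A : comNzRingType) (G : set A) c x :
  ideal_gen G x -> ideal_gen G (c * x).
Proof.
move: x; apply: ideal_gen_ind => [|x y Hx Hy|c' x Gx].
- by rewrite mulr0; apply: ideal_gen0.
- by rewrite mulrDr; apply: ideal_genD.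
- by rewrite mulrA; apply: ideal_gen_mul.
Qed.

Lemma ideal_gen_sub (A : comNzRingType) (G : set A) : G `<=` ideal_gen G.
Proof. by move=> x Gx; rewrite -[x]mul1r; apply: ideal_gen_mul. Qed.

Lemma ideal_pow_sum (A : comNzRingType) (J : set A) k (T : Type) (s : seq T)
    (P : pred T) (F : T -> A) :
  (forall i, P i -> ideal_pow J k (F i)) ->
  ideal_pow J k (\sum_(i <- s | P i) F i).
Proof.
by move=> HF; apply: big_ind => //; [apply: ideal_gen0 | apply: ideal_genD].
Qed.

Lemma ideal_pow0 (A : comNzRingType) (J : set A) x : ideal_pow J 0 x.
Proof.
rewrite -[x]mulr1; apply: ideal_gen_mul.
by exists (fun=> 0); [case | rewrite big_ord0].
Qed.

Lemma ideal_pow1 (A : comNzRingType) (J : set A) x : J x -> ideal_pow J 1 x.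
Proof.
by move=> Jx; apply: ideal_gen_sub; exists (fun=> x); rewrite ?big_ord1.
Qed.

Lemma ideal_powM (A : comNzRingType) (J : set A) k l x y :
  ideal_pow J k x -> ideal_pow J l y -> ideal_pow J (k + l) (x * y).
Proof.
move=> Hx Hy; move: x Hx; apply: ideal_gen_ind => [|x x' Hx Hx'|c _ [u Ju ->]].
- by rewrite mul0r; apply: ideal_gen0.
- by rewrite mulrDl; apply: ideal_genD.
rewrite -mulrA; apply: ideal_genM.
move: y Hy; apply: ideal_gen_ind => [|y y' Hy Hy'|c' _ [u' Ju' ->]].
- by rewrite mulr0; apply: ideal_gen0.
- by rewrite mulrDr; apply: ideal_genD.
rewrite mulrCA; apply: ideal_gen_mul.
exists (fun i => match split i with inl j => u j | inr j => u' j end).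
  by move=> i; case: (split i).
rewrite big_split_ord; congr (_ * _); apply: eq_bigr => i _.
  by rewrite (unsplitK (inl _ i)).
by rewrite (unsplitK (inr _ i)).
Qed.

Lemma ideal_powX (A : comNzRingType) (J : set A) k x :
  J x -> ideal_pow J k (x ^+ k).
Proof.
move=> Jx; elim: k => [|k IH]; first exact: ideal_pow0.
by rewrite exprS -add1n; apply: ideal_powM => //; apply: ideal_pow1.
Qed.

Lemma ideal_pow_mul (A : comNzRingType) (J : set A) c N :
  ideal_pow J (N * c) `<=` ideal_pow (ideal_pow J c) N.
Proof.
apply: ideal_gen_ind => [|x y|e _ [y Jy ->]]; first exact: ideal_gen0.
  exact: ideal_genD.
apply: ideal_genM; elim: N y Jy => [|N IH] y Jy; first exact: ideal_pow0.
have -> : \prod_(i < N.+1 * c) y i =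
    (\prod_(i < c) y (lshift (N * c) i)) * \prod_(i < N * c) y (rshift c i).
  exact: (@big_split_ord _ _ _ c (N * c) xpredT y).
rewrite -[N.+1]add1n; apply: ideal_powM; last by apply: IH.
by apply/ideal_pow1/ideal_gen_sub; exists (fun i => y (lshift (N * c) i)).
Qed.

Lemma ideal_pow_rmorph (A B : comNzRingType) (f : {rmorphism A -> B})
    (J : set A) (J' : set B) k x :
  (forall y, J y -> J' (f y)) -> ideal_pow J k x -> ideal_pow J' k (f x).
Proof.
move=> fJ; move: x; apply: ideal_gen_ind => [|x y Hx Hy|c _ [y Jy ->]].
- by rewrite rmorph0; apply: ideal_gen0.
- by rewrite rmorphD; apply: ideal_genD.
rewrite rmorphM rmorph_prod; apply: ideal_gen_mul.
by exists (fun i => f (y i)) => // i; apply: fJ.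
Qed.

(** [z] is a root of the monic polynomial ['X^N - (z ^+ N)%:P], whose constant
    term lies in [(J^c)^N]. *)
Lemma integral_closure_root (A : comNzRingType) (J : set A) c N z :
  (0 < N)%N -> ideal_pow J (N * c) (z ^+ N) ->
  integral_closure (ideal_pow J c) z.
Proof.
move=> N0 HzN; exists N, (fun i => if i == N then - z ^+ N else 0); split=> //.
  move=> i _; case: eqP => [->|_]; last exact: ideal_gen0.
  by rewrite -mulN1r; apply/ideal_genM/ideal_pow_mul.
rewrite big_nat_recr //= eqxx subnn expr0 mulr1 big1_seq ?add0r ?subrr //.
move=> i /andP[_]; rewrite mem_index_iota => /andP[_ iN].
by rewrite ltn_eqF // mul0r.
Qed.

(** * The Rees algebra as a subring *)

Lemma rees_algebraD (A : comNzRingType) (J : set A) p p' :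
  rees_algebra J p -> rees_algebra J p' -> rees_algebra J (p + p').
Proof. by move=> Hp Hp' k; rewrite coefD; apply: ideal_genD (Hp k) (Hp' k). Qed.

Lemma rees_algebraN (A : comNzRingType) (J : set A) p :
  rees_algebra J p -> rees_algebra J (- p).
Proof. by move=> Hp k; rewrite coefN -mulN1r; apply: ideal_genM (Hp k). Qed.

Lemma rees_algebraM (A : comNzRingType) (J : set A) p p' :
  rees_algebra J p -> rees_algebra J p' -> rees_algebra J (p * p').
Proof.
move=> Hp Hp' k; rewrite coefM; apply: ideal_pow_sum => i _.
rewrite -[X in ideal_pow _ X](subnKC (ltn_ord i : (i <= k)%N)).
exact: ideal_powM.
Qed.

Lemma rees_algebra_monom (A : comNzRingType) (J : set A) k x :
  ideal_pow J k x -> rees_algebra J (x *: 'X^k).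
Proof.
move=> Hx i; rewrite coefZ coefXn; case: eqP => [->|_]; first by rewrite mulr1.
by rewrite mulr0; apply: ideal_gen0.
Qed.

(** * Exponents of the monomials of the Rees algebra *)

(** The exponents of the monomials [x^b t^c] of [R[It]] when [I] is generated
    by the [x^(v_j)]: the sums of vectors [(v_j, 1)] and [e_i], the
    coefficients of the [e_i] being the slacks of the inequalities. *)
Definition rees_exponent (n q : nat) (v : 'I_q -> 'X_{1..n})
    (b : 'X_{1..n}) (c : nat) : Prop :=
  exists2 w : 'I_q -> nat, (\sum_j w j)%N = c &
    forall i, (\sum_j w j * v j i <= b i)%N.

Lemma rees_exponent0 (n q : nat) (v : 'I_q -> 'X_{1..n}) b :
  rees_exponent v b 0.
Proof.
by exists (fun=> 0%N) => [|i]; rewrite ?big1 // => j _; rewrite mul0n.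
Qed.

Lemma rees_exponent_gen (n q : nat) (v : 'I_q -> 'X_{1..n}) j :
  rees_exponent v (v j) 1.
Proof.
exists (fun j' => (j' == j) : nat) => [|i].
  by rewrite (bigD1 j) //= eqxx big1 ?addn0 // => j' /negPf ->.
rewrite (bigD1 j) //= eqxx mul1n big1 ?addn0 // => j' /negPf ->.
by rewrite mul0n.
Qed.

Lemma rees_exponentD (n q : nat) (v : 'I_q -> 'X_{1..n}) b c b' c' :
  rees_exponent v b c -> rees_exponent v b' c' ->
  rees_exponent v (b + b')%MM (c + c').
Proof.
move=> [w <- wb] [w' <- wb']; exists (fun j => w j + w' j)%N => [|i].
  by rewrite big_split.
rewrite mnmDE; under eq_bigr => j _ do rewrite mulnDl.
by rewrite big_split leq_add.
Qed.

Lemma ideal_pow_supp (K : fieldType) (n q : nat) (v : 'I_q -> 'X_{1..n})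
    (I : set {mpoly K[n]}) k p m :
  I = ideal_gen [set 'X_[v j] | j in [set: 'I_q]] ->
  ideal_pow I k p -> m \in msupp p -> rees_exponent v m k.
Proof.
move=> Igen.
pose T l : set {mpoly K[n]} :=
  [set x | forall m', m' \in msupp x -> rees_exponent v m' l].
have T0 l : T l 0 by move=> m'; rewrite msupp0.
have TD l x y : T l x -> T l y -> T l (x + y).
  by move=> Hx Hy m' /msuppD_le; rewrite mem_cat => /orP[/Hx|/Hy].
have TM l l' x y : T l x -> T l' y -> T (l + l')%N (x * y).
  move=> Hx Hy m' /msuppM_le /allpairsP[[m1 m2] /= [/Hx H1 /Hy H2 ->]].
  exact: rees_exponentD.
have TT x : T 0%N x by move=> m' _; apply: rees_exponent0.
have IT x : I x -> T 1%N x.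
  rewrite Igen; move: x; apply: ideal_gen_ind => // [x y|c _ [j _ <-]].
    exact: TD.
  rewrite -[1%N]add0n; apply: TM => // m'; rewrite msuppX inE => /eqP ->.
  exact: rees_exponent_gen.
suff: ideal_pow I k `<=` T k by move=> sub /sub; apply.
apply: ideal_gen_ind => // [x y|c _ [y Iy ->]]; first exact: TD.
apply: (TM 0%N k) => //.
suff: T (\sum_(i < k) 1)%N (\prod_(i < k) y i) by rewrite sum1_card card_ord.
by elim/big_rec2: _ => // i y1 y2 _ H; apply: TM => //; apply: IT.
Qed.

Lemma monomial_ideal_pow (K : fieldType) (n q : nat) (J : set {mpoly K[n]})
    (u : 'I_q -> 'X_{1..n}) (w : 'I_q -> nat) (b : 'X_{1..n}) :
  (forall j, (0 < w j)%N -> J 'X_[u j]) ->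
  (forall i, \sum_j w j * u j i <= b i)%N ->
  ideal_pow J (\sum_j w j) 'X_[b].
Proof.
move=> Ju wb; pose s := (\sum_j u j *+ w j)%MM.
have sb : (s <= b)%MM.
  apply/mnm_lepP => i; rewrite mnm_sumE; apply: leq_trans (wb i).
  by apply: leq_sum => j _; rewrite mulmnE mulnC.
rewrite -(submK sb) mpolyXD; apply: ideal_genM.
rewrite (big_morph _ (@mpolyXD n K) (@mpolyX0 n K)).
elim/big_rec2: _ => [|j y1 y2 _ IH]; first exact: ideal_pow0.
apply: ideal_powM => //; rewrite -mpolyXn.
have [w0|] := posnP (w j); first by rewrite w0; apply: ideal_pow0.
by move=> /Ju; apply: ideal_powX.
Qed.

(** * Division by leading terms *)

Lemma mlead_cancel (K : fieldType) (n : nat) (p p' : {mpoly K[n]}) :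
  p != 0 -> mlead p' = mlead p -> mleadc p' = mleadc p ->
  p - p' = 0 \/ (mlead (p - p') < mlead p)%O.
Proof.
move=> p0 eqm eqc; have [->|d0] := eqVneq (p - p') 0; [by left | right].
rewrite lt_neqAle; apply/andP; split; last first.
  by apply: le_trans (mleadB_le _ _) _; rewrite eqm joinxx.
apply: contraNneq d0 => eqd; rewrite -mleadc_eq0 eqd mcoeffB -{2}eqm.
by rewrite eqc subrr.
Qed.

Lemma leq_of_multiples (m0 x y : nat) :
  (forall k, k * x <= m0 + k * y)%N -> (x <= y)%N.
Proof.
move=> H; rewrite leqNgt; apply/negP => yx.
by have := H m0.+1; have := leq_mul (leqnn m0.+1) yx; nia.
Qed.

Lemma size_mul_exp (A : idomainType) (d f : {poly A}) k :
  d != 0 -> f != 0 ->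
  (size (d * f ^+ k)).-1 = ((size d).-1 + k * (size f).-1)%N.
Proof.
move=> d0 f0; rewrite size_mul ?expf_neq0 //.
have d1 : (0 < size d)%N by rewrite size_poly_gt0.
have f1 : (0 < size (f ^+ k))%N by rewrite size_poly_gt0 expf_neq0.
by rewrite mulnC -size_exp -(prednK d1) -(prednK f1) addSn addnS.
Qed.

(** The set [S] is a subring of [K[x, t]] whose exponents lie in [T] and which
    contains the monomials with exponent in [T].  If [d (f / g)^k] lies in [S]
    for all [k], the leading exponent of [d (f / g)^k] is that of [d] plus [k]
    times the difference of the leading exponents of [f] and [g]; saturation of
    [T] puts this difference into [T], so a multiple of [g] by a monomial of [S]
    cancels the leading term of [f].  This changes [f / g] by an element of [S],
    so that the hypothesis persists, and the division terminates because terms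
    are well-ordered. *)
Lemma division_almost_integral (K : fieldType) (n : nat)
    (S : set {poly {mpoly K[n]}}) (T : 'X_{1..n} -> nat -> Prop)
    (d f g : {poly {mpoly K[n]}}) :
  S 0 -> (forall x y, S x -> S y -> S (x + y)) ->
  (forall x, S x -> S (- x)) ->
  (forall x y, S x -> S y -> S (x * y)) ->
  (forall s, S s -> s != 0 -> T (mlead (lead_coef s)) (size s).-1) ->
  (forall e b c, T b c -> S ((e *: 'X_[b]) *: 'X^c)) ->
  (forall b0 c0 b c, (forall k, T (b0 + b *+ k)%MM (c0 + k * c)%N) -> T b c) ->
  d != 0 -> g != 0 ->
  (forall k, exists2 s, S s & d * f ^+ k = s * g ^+ k) ->
  exists2 s, S s & f = s * g.
Proof.
move=> S0 SD SN SM ST TS Tsat d0 g0.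
have [N leN] := ubnP (size f).
elim: N f leN => // N IHN f leN.
move: {2}(lead_coef f) (erefl (lead_coef f)) => lf.
elim/(@mleadrect n K): lf f leN => lf IHlf f leN deflf Hf.
have [->|f0] := eqVneq f 0; first by exists 0; rewrite ?mul0r.
pose b := (mlead (lead_coef f) - mlead (lead_coef g))%MM.
pose c := ((size f).-1 - (size g).-1)%N.
have exps k : exists2 s, S s & s != 0 /\
    (mlead (lead_coef d) + mlead (lead_coef f) *+ k =
       mlead (lead_coef s) + mlead (lead_coef g) *+ k)%MM /\
    ((size d).-1 + k * (size f).-1 = (size s).-1 + k * (size g).-1)%N.
  have [s Ss eqs] := Hf k; exists s => //.
  have s0 : s != 0.
    have: d * f ^+ k != 0 by rewrite mulf_neq0 // expf_neq0.
    by apply: contraNneq => s0; rewrite eqs s0 mul0r.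
  split=> //; split.
    have := congr1 (fun x : {poly {mpoly K[n]}} => mlead (lead_coef x)) eqs.
    rewrite /= !lead_coefM !lead_coef_exp !mleadM ?expf_neq0 ?lead_coef_eq0 //.
    by rewrite !mleadX // lead_coef_eq0.
  have := congr1 (fun x : {poly {mpoly K[n]}} => (size x).-1) eqs.
  by rewrite /= !size_mul_exp.
have le_b : (mlead (lead_coef g) <= mlead (lead_coef f))%MM.
  apply/mnm_lepP => i; apply: (@leq_of_multiples (mlead (lead_coef d) i)) => k.
  have [s _ [_ [/(congr1 (fun m : 'X_{1..n} => m i)) eqk _]]] := exps k.
  by move: eqk; rewrite !mnmDE !mulmnE; lia.
have le_c : ((size g).-1 <= (size f).-1)%N.
  apply: (@leq_of_multiples (size d).-1) => k.
  by have [s _ [_ [_ eqk]]] := exps k; lia.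
have Tbc : T b c.
  apply: (Tsat (mlead (lead_coef d)) (size d).-1) => k.
  have [s Ss [s0 [eqm eqn]]] := exps k; have := ST s Ss s0.
  have -> : mlead (lead_coef s) = (mlead (lead_coef d) + b *+ k)%MM.
    apply/mnmP => i; move/(congr1 (fun m : 'X_{1..n} => m i)): eqm.
    have /mnm_lepP/(_ i) := le_b.
    by rewrite !(mnmDE, mulmnE, mnmBE); nia.
  by have -> : (size s).-1 = ((size d).-1 + k * c)%N by rewrite /c; nia.
have lf0 : lead_coef f != 0 by rewrite lead_coef_eq0.
have lg0 : lead_coef g != 0 by rewrite lead_coef_eq0.
have mf0 : mleadc (lead_coef f) != 0 by rewrite mleadc_eq0.
have mg0 : mleadc (lead_coef g) != 0 by rewrite mleadc_eq0.
pose e := mleadc (lead_coef f) / mleadc (lead_coef g).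
have e0 : e != 0 by rewrite mulf_neq0 ?invr_neq0.
pose h : {poly {mpoly K[n]}} := (e *: 'X_[b]) *: 'X^c.
have Sh : S h by apply: TS.
have eX0 : e *: 'X_[b] != 0 :> {mpoly K[n]}.
  by rewrite -msupp_eq0 msuppMCX.
have hgE : h * g = (e *: 'X_[b]) *: (g * 'X^c) by rewrite -scalerAl mulrC.
have size_hg : size (h * g) = size f.
  rewrite hgE size_scale // size_mulXn // /c.
  have arith x y : (0 < x -> 0 < y -> y.-1 <= x.-1 ->
    x.-1 - y.-1 + y = x)%N by clear; lia.
  by apply: arith => //; rewrite size_poly_gt0.
have lead_hg : lead_coef (h * g) = e *: 'X_[b] * lead_coef g.
  by rewrite hgE lead_coefZ lead_coefM lead_coefXn mulr1.
have mlead_hg : mlead (lead_coef (h * g)) = mlead (lead_coef f).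
  by rewrite lead_hg mleadM // mleadZ // mleadXm /b submK.
have mleadc_hg : mleadc (lead_coef (h * g)) = mleadc (lead_coef f).
  rewrite lead_hg mleadM // mleadcM mleadcZE mleadXm mcoeffX eqxx mulr1 /e.
  by rewrite mulfVK.
pose f' := f - h * g.
have Hf' k : exists2 s, S s & d * f' ^+ k = s * g ^+ k.
  (* The factor [f ^+ l] makes the induction on [k] go through, one factor [f']
     being expanded as [f - h * g]. *)
  suff gen l : exists2 s, S s & d * f ^+ l * f' ^+ k = s * g ^+ (l + k).
    by have := gen 0%N; rewrite expr0 mulr1 add0n.
  elim: k l => [|k IH] l; first by rewrite expr0 mulr1 addn0; apply: Hf.
  have [s1 Ss1 e1] := IH l.+1; have [s2 Ss2 e2] := IH l.
  exists (s1 - h * s2); first by apply: SD => //; apply: SN; apply: SM.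
  have -> : d * f ^+ l * f' ^+ k.+1 =
      d * f ^+ l.+1 * f' ^+ k - h * g * (d * f ^+ l * f' ^+ k).
    by rewrite !exprS [in f' * _]/f'; ring.
  by rewrite e1 e2 addSnnS addnS exprS; ring.
suff [s Ss eqs] : exists2 s, S s & f' = s * g.
  by exists (s + h); [apply: SD | rewrite mulrDl -eqs /f' subrK].
have le_f' : (size f' <= size f)%N.
  by rewrite (leq_trans (size_polyD _ _)) // size_polyN size_hg maxnn.
(* Cancelling the leading term lowers the degree in [t], or else the leading
   monomial of the leading coefficient. *)
have [szf'|szf'] := ltnP (size f') (size f).
  by apply: IHN => //; apply: leq_trans szf' _.
have {}szf' : size f' = size f by apply/eqP; rewrite eqn_leq le_f'.
have lead_f' : lead_coef f' = lead_coef f - lead_coef (h * g).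
  by rewrite !lead_coefE szf' size_hg coefB.
have [lead0|ltf'] := mlead_cancel lf0 mlead_hg mleadc_hg.
  exists 0 => //; apply/eqP; rewrite mul0r -lead_coef_eq0 lead_f'.
  exact/eqP.
by apply: (IHlf (lead_coef f')) => //; rewrite -?deflf ?lead_f' ?szf'.
Qed.

(** * The Rees cone *)

Lemma dotvE (F : pzRingType) m (u w : 'rV[F]_m) : dotv u w = (u *m w^T) 0 0.
Proof. by rewrite mxE; apply: eq_bigr => i _; rewrite mxE. Qed.

Lemma dotvDl (F : pzRingType) m (u u' w : 'rV[F]_m) :
  dotv (u + u') w = dotv u w + dotv u' w.
Proof. by rewrite !dotvE mulmxDl mxE. Qed.

Lemma dotvZl (F : pzRingType) m c (u w : 'rV[F]_m) :
  dotv (c *: u) w = c * dotv u w.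
Proof. by rewrite !dotvE -scalemxAl mxE. Qed.

Lemma dotv_suml (F : pzRingType) m (T : finType) (f : T -> 'rV[F]_m) w :
  dotv (\sum_i f i) w = \sum_i dotv (f i) w.
Proof.
by rewrite dotvE mulmx_suml summxE; apply: eq_bigr => i _; rewrite dotvE.
Qed.

Lemma dotv_delta (F : pzRingType) m (u : 'rV[F]_m) i :
  dotv u (delta_mx 0 i) = u 0 i.
Proof.
rewrite /dotv (bigD1 i) //= big1 ?addr0 => [|j ji]; rewrite !mxE !eqxx /=.
  by rewrite mulr1.
by rewrite (negPf ji) mulr0.
Qed.

Lemma cone_gen (R : realType) m (B : set 'rV[R]_m) c u :
  0 <= c -> B u -> cone B (c *: u).
Proof.
by move=> c0 Bu; exists 1%N, (fun=> c), (fun=> u); rewrite big_ord1.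
Qed.

Lemma cone0 (R : realType) m (B : set 'rV[R]_m) : cone B 0.
Proof.
by exists 0%N, (fun=> 0), (fun=> 0); split=> [[]//|]; rewrite big_ord0.
Qed.

Lemma coneD (R : realType) m (B : set 'rV[R]_m) u u' :
  cone B u -> cone B u' -> cone B (u + u').
Proof.
move=> [k [c [w [Bw ->]]]] [k' [c' [w' [Bw' ->]]]].
exists (k + k')%N,
  (fun i => match split i with inl j => c j | inr j => c' j end),
  (fun i => match split i with inl j => w j | inr j => w' j end).
split=> [i|]; first by case: (split i).
rewrite big_split_ord; congr (_ + _); apply: eq_bigr => i _.
  by rewrite (unsplitK (inl _ i)).
by rewrite (unsplitK (inr _ i)).
Qed.

Lemma cone_sum (R : realType) m (B : set 'rV[R]_m) (T : finType)
    (c : T -> R) (u : T -> 'rV[R]_m) :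
  (forall i, 0 <= c i) -> (forall i, B (u i)) ->
  cone B (\sum_i c i *: u i).
Proof.
move=> c0 Bu; apply: big_ind => [|x y|i _]; first exact: cone0.
  exact: coneD.
exact: cone_gen.
Qed.

Definition rees_point (F : pzRingType) (n : nat) (b : 'X_{1..n}) (c : nat) :
    'rV[F]_(n + 1) :=
  row_mx (\row_(i < n) (b i)%:R) (const_mx c%:R).

Lemma rees_point_l (F : pzRingType) n (b : 'X_{1..n}) c i :
  rees_point F b c 0 (lshift 1 i) = (b i)%:R.
Proof. by rewrite row_mxEl mxE. Qed.

Lemma rees_point_r (F : pzRingType) n (b : 'X_{1..n}) c i :
  rees_point F b c 0 (rshift n i) = c%:R.
Proof. by rewrite row_mxEr mxE. Qed.

Lemma rees_pointD (F : pzRingType) n (b b' : 'X_{1..n}) c c' :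
  rees_point F (b + b')%MM (c + c') = rees_point F b c + rees_point F b' c'.
Proof.
apply/rowP => i; rewrite [RHS]mxE; case: (split_ordP i) => j ->.
  by rewrite !rees_point_l mnmDE natrD.
by rewrite !rees_point_r natrD.
Qed.

Lemma rees_pointMn (F : pzRingType) n (b : 'X_{1..n}) c k :
  rees_point F (b *+ k)%MM (k * c) = k%:R *: rees_point F b c.
Proof.
apply/rowP => i; rewrite [RHS]mxE; case: (split_ordP i) => j ->.
  by rewrite !rees_point_l mulmnE mulnC natrM.
by rewrite !rees_point_r natrM.
Qed.

Lemma rees_cone_gen (R : realType) (n q : nat) (v : 'I_q -> 'X_{1..n}) j :
  rees_generators R v (rees_point R (v j) 1).
Proof. by right; exists j. Qed.

(** This serves to produce points of the cone and, conversely, to tell which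
    generators occur in a given point. *)
Lemma rees_slack_decomposition (R : realType) (n q : nat)
    (v : 'I_q -> 'X_{1..n}) (D : 'I_q -> R) (u : 'rV[R]_(n + 1)) :
  \sum_j D j = u 0 (rshift n ord0) ->
  u = \sum_j D j *: rees_point R (v j) 1 +
      \sum_i (u 0 (lshift 1 i) - \sum_j D j * (v j i)%:R)
        *: delta_mx 0 (lshift 1 i).
Proof.
move=> sD; apply/rowP => i; rewrite mxE !summxE.
case: (split_ordP i) => j ->.
  under eq_bigr => k _ do rewrite mxE rees_point_l.
  rewrite [X in _ + X](bigD1 j) //= [X in _ + (_ + X)]big1.
    by rewrite !mxE !eqxx mulr1 addr0 subrKC.
  by move=> k kj; rewrite !mxE eqxx eq_lshift eq_sym (negPf kj) mulr0.
under eq_bigr => k _ do rewrite mxE rees_point_r mulr1.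
rewrite ord1 sD big1 ?addr0 // => k _.
by rewrite !mxE eqxx eq_rlshift mulr0.
Qed.

Lemma rees_coneP (R : realType) (n q : nat) (v : 'I_q -> 'X_{1..n})
    (u : 'rV[R]_(n + 1)) :
  rees_cone R v u <->
  exists D : 'I_q -> R,
    [/\ forall j, 0 <= D j, \sum_j D j = u 0 (rshift n ord0) &
        forall i, \sum_j D j * (v j i)%:R <= u 0 (lshift 1 i)].
Proof.
split=> [|[D [D0 sD Du]]]; last first.
  rewrite (rees_slack_decomposition v sD); apply: coneD.
    by apply: cone_sum => // j; apply: rees_cone_gen.
  by apply: cone_sum => i; [rewrite subr_ge0 | left; exists i].
move=> [k [c [w [cw ->]]]].
pose T := [set u : 'rV[R]_(n + 1) | exists D : 'I_q -> R,
    [/\ forall j, 0 <= D j, \sum_j D j = u 0 (rshift n ord0) &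
        forall i, \sum_j D j * (v j i)%:R <= u 0 (lshift 1 i)]].
apply: (big_ind T) => [|x y [D [D0 sD Dx]] [D' [D'0 sD' Dy]]|i _].
- exists (fun=> 0); split=> // [|i]; rewrite big1 ?mxE // => j _.
  by rewrite mul0r.
- exists (fun j => D j + D' j); split=> [j||i].
  + exact: addr_ge0.
  + by rewrite big_split /= sD sD' mxE.
  + under eq_bigr => j _ do rewrite mulrDl.
    by rewrite big_split mxE lerD.
have [c0 [[l ->]|[l ->]]] := cw i.
  exists (fun=> 0); split=> // [|i']; rewrite big1 ?mxE.
  - by rewrite eq_rlshift andbF mulr0.
  - by [].
  - by apply: mulr_ge0.
  - by move=> j _; rewrite mul0r.
exists (fun j => if j == l then c i else 0); split=> [j||i'].
- by case: ifP.
- by rewrite -big_mkcond big_pred1_eq mxE row_mxEr mxE mulr1.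
- under eq_bigr => j _ do rewrite (fun_if ( *%R^~ _)) mul0r.
  by rewrite -big_mkcond big_pred1_eq mxE row_mxEl mxE.
Qed.

Lemma rees_exponent_cone (R : realType) (n q : nat) (v : 'I_q -> 'X_{1..n})
    b c :
  rees_exponent v b c -> rees_cone R v (rees_point R b c).
Proof.
move=> [w wc wb]; apply/rees_coneP; exists (fun j => (w j)%:R).
rewrite rees_point_r -wc natr_sum; split=> // i; rewrite rees_point_l.
under eq_bigr => j _ do rewrite -natrM.
by rewrite -natr_sum ler_nat.
Qed.

(** * Rational solutions of rational linear systems *)

(** The rational solutions are dense in the real ones: they form an affine space
    directed by the row space of a rational kernel matrix, and the coordinates
    on the latter can be moved to nearby rational numbers. *)
Lemma rational_positive_solution (R : realType) p m (A : 'M[rat]_(p, m))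
    (u : 'rV[rat]_m) (x : 'rV[R]_p) :
  (forall j, 0 < x 0 j) -> x *m map_mx ratr A = map_mx ratr u ->
  exists2 y : 'rV[rat]_p, (forall j, 0 < y 0 j) & y *m A = u.
Proof.
move=> x0 xA.
have /submxP[y0 uE] : (u <= A)%MS.
  by rewrite -(map_submx (ratr : {rmorphism rat -> R})) -xA submxMl.
have /submxP[z zE] : (x - map_mx ratr y0 <= map_mx ratr (kermx A))%MS.
  rewrite map_kermx; apply/sub_kermxP.
  by rewrite mulmxBl xA -map_mxM -uE subrr.
(* Moving each [z 0 i] by less than [e / M] moves the coordinates of the
   solution by less than [e], a lower bound of those of [x]. *)
pose M : R := 1 + \sum_i \sum_j `|ratr (kermx A i j)|.
have M0 : 0 < M.
  by rewrite ltr_pwDl // sumr_ge0 // => i _; rewrite sumr_ge0.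
have [e e0 ex] : exists2 e : R, 0 < e & forall j, e <= x 0 j.
  exists (\big[Num.min/1]_j x 0 j); last by move=> j; apply: bigmin_le.
  by apply: lt_bigmin.
have eM : 0 < e / M by apply: divr_gt0.
have near (t : R) : exists s : rat, `|ratr s - t| < e / M.
  have lt_t : t - e / M < t + e / M by lra.
  have [s] := rat_in_itvoo lt_t; rewrite in_itv /= => lt_s.
  by exists s; rewrite ltr_distl.
have [z' z'E] := choice (fun i => near (z 0 i)).
exists (y0 + (\row_i z' i) *m kermx A) => [j|].
  rewrite -(ltr0q R).
  have -> : ratr ((y0 + (\row_i z' i) *m kermx A) 0 j) =
      x 0 j + \sum_i (ratr (z' i) - z 0 i) * ratr (kermx A i j).
    have /(congr1 (fun w : 'rV[R]_p => w 0 j)) := zE.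
    rewrite !mxE rmorphD rmorph_sum /= => /eqP; rewrite subr_eq => /eqP ->.
    rewrite addrAC addrC -big_split; congr (_ + _); apply: eq_bigr => i _ /=.
    by rewrite !mxE rmorphM /=; ring.
  rewrite -ltrBlDr sub0r; apply: le_lt_trans (ler_norm _) _; rewrite normrN.
  apply: le_lt_trans (ler_norm_sum _ _ _) _.
  apply: lt_le_trans (ex j); rewrite -[e](divfK (lt0r_neq0 M0)).
  have le_ker : \sum_i `|ratr (kermx A i j) : R| < M.
    rewrite ltr_pwDl // ler_sum // => i _.
    by rewrite (bigD1 j) //= lerDl sumr_ge0.
  apply: le_lt_trans (_ : e / M * \sum_i `|ratr (kermx A i j)| < _).
    rewrite mulr_sumr ler_sum // => i _.
    by rewrite normrM ler_wpM2r // ltW.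
  by rewrite ltr_pM2l.
by rewrite mulmxDl -uE -mulmxA mulmx_ker mulmx0 addr0.
Qed.

(** The rows with coefficient zero are replaced by zero rows and their
    coefficients by one, which reduces to the positive case. *)
Lemma rational_nonneg_solution (R : realType) p m (A : 'M[rat]_(p, m))
    (u : 'rV[rat]_m) (x : 'rV[R]_p) :
  (forall j, 0 <= x 0 j) -> x *m map_mx ratr A = map_mx ratr u ->
  exists2 y : 'rV[rat]_p, (forall j, 0 <= y 0 j) & y *m A = u.
Proof.
move=> x0 xA.
pose A' := \matrix_(i, j) if x 0 i == 0 then 0 else A i j.
pose x' := \row_i if x 0 i == 0 then 1 else x 0 i.
have [||y y0 yA] := @rational_positive_solution R p m A' u x'.
- by move=> j; rewrite mxE; case: eqP => // /eqP xj; rewrite lt_def xj x0.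
- rewrite -xA; apply/rowP => j; rewrite !mxE; apply: eq_bigr => i _.
  by rewrite !mxE; case: eqP => // ->; rewrite rmorph0 mulr0 mul0r.
exists (\row_i if x 0 i == 0 then 0 else y 0 i).
  by move=> j; rewrite mxE; case: ifP => // _; apply: ltW.
rewrite -yA; apply/rowP => j; rewrite !mxE; apply: eq_bigr => i _.
by rewrite !mxE; case: eqP; rewrite ?mul0r ?mulr0.
Qed.

Lemma common_denominator q (D : 'I_q -> rat) :
  (forall j, 0 <= D j) ->
  exists N (w : 'I_q -> nat), (0 < N)%N /\
    forall j, N%:R * D j = (w j)%:R.
Proof.
move=> D0; exists (\prod_j `|denq (D j)|)%N.
exists (fun j => `|numq (D j)| * \prod_(i | i != j) `|denq (D i)|)%N.
split=> [|j].
  by rewrite prodn_gt0 // => j; rewrite absz_gt0 denq_neq0.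
rewrite (bigD1 j) //= !natrM !pmulrn.
rewrite !gez0_abs ?numq_ge0 ?denq_ge0 // mulrAC; congr (_ * _).
by rewrite mulrC -{1}(divq_num_den (D j)) mulfVK // intr_eq0 denq_neq0.
Qed.

(** The slacks enter the linear system as unknowns, since they must remain
    nonnegative for the rational solution. *)
Lemma rees_cone_multiple (R : realType) (n q : nat) (v : 'I_q -> 'X_{1..n})
    b c :
  rees_cone R v (rees_point R b c) ->
  exists2 N, (0 < N)%N & rees_exponent v (b *+ N)%MM (N * c).
Proof.
move=> /rees_coneP[D [D0 sD Db]]; move: sD; rewrite rees_point_r => sD.
pose A : 'M[rat]_(q + n, n + 1) :=
  block_mx (\matrix_(j, i) (v j i)%:R) (const_mx 1) 1%:M 0.
pose x : 'rV[R]_(q + n) :=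
  row_mx (\row_j D j) (\row_i ((b i)%:R - \sum_j D j * (v j i)%:R)).
have [||y y0 yA] := @rational_nonneg_solution R _ _ A (rees_point _ b c) x.
- move=> j; case: (split_ordP j) => i ->; first by rewrite row_mxEl mxE.
  by rewrite row_mxEr mxE subr_ge0 -(rees_point_l R b c i).
- rewrite map_block_mx map_row_mx mul_row_block map_mx1 raddf0 mulmx1 mulmx0.
  congr row_mx; apply/rowP => i; rewrite !mxE.
    rewrite ratr_nat; under eq_bigr => j _ do rewrite !mxE ratr_nat.
    exact: subrKC.
  rewrite addr0 ratr_nat -sD; apply: eq_bigr => j _.
  by rewrite !mxE rmorph1 mulr1.
have [N [w [N0 wE]]] :=
  @common_denominator q (fun j => y 0 (lshift n j)) (fun j => y0 _).
rewrite -[y]hsubmxK mul_row_block in yA.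
exists N => //; exists w => [|i].
  apply/eqP; rewrite -(eqr_nat rat) natr_sum natrM.
  have /(congr1 (fun u : 'rV[rat]_(n + 1) => u 0 (rshift n ord0))) := yA.
  rewrite rees_point_r row_mxEr mulmx0 addr0 mxE => <-.
  rewrite mulr_sumr; apply/eqP/eq_bigr => j _.
  by rewrite -wE !mxE mulr1.
rewrite mulmnE mulnC -(ler_nat rat) natr_sum natrM.
have /(congr1 (fun u : 'rV[rat]_(n + 1) => u 0 (lshift 1 i))) := yA.
rewrite rees_point_l row_mxEl mulmx1 2!mxE => <-.
rewrite mulrDr mulr_sumr -[leLHS]addr0 lerD ?mulr_ge0 //; last by rewrite mxE.
by apply: ler_sum => j _; rewrite natrM -wE !mxE mulrA.
Qed.

(** * Lattice points of the Rees cone *)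

Lemma ge0_of_multiples (R : realType) (s t : R) :
  (forall k : nat, 0 <= s + k%:R * t) -> 0 <= t.
Proof.
move=> H; rewrite leNgt; apply/negP => t0.
have s0 : 0 <= s by have := H 0%N; rewrite mul0r addr0.
have nt0 : 0 < - t by rewrite oppr_gt0.
have := archi_boundP (divr_ge0 s0 (ltW nt0)).
by rewrite ltr_pdivrMr //; have := H (Num.bound (s / - t)); lra.
Qed.

(** Letting [k] grow in the inequalities satisfied by [(b0, c0) + k (b, c)]
    gives those of [(b, c)]. *)
Lemma rees_cone_saturated (R : realType) (n q : nat) (v : 'I_q -> 'X_{1..n})
    (T : Type) (A : T -> 'rV[R]_(n + 1)) b0 c0 b c :
  rees_cone R v = \bigcap_(k in [set: T]) halfspace (A k) ->
  (forall k, rees_exponent v (b0 + b *+ k)%MM (c0 + k * c)) ->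
  rees_cone R v (rees_point R b c).
Proof.
move=> coneE H; rewrite coneE => k _.
apply: (@ge0_of_multiples _ (dotv (rees_point R b0 c0) (A k))) => m.
have := rees_exponent_cone R (H m); rewrite coneE => /(_ k I).
by rewrite rees_pointD rees_pointMn /halfspace /= dotvDl dotvZl.
Qed.

(** Otherwise the multiple [x^(v_j)] of [x^(v_j')] could be removed from the
    generating set. *)
Lemma mingen_antichain (K : fieldType) (n q : nat) (v : 'I_q -> 'X_{1..n})
    (I : set {mpoly K[n]}) j j' :
  injective v ->
  minimally_generated_by I [set 'X_[v j] | j in [set: 'I_q]] ->
  (v j' <= v j)%MM -> j' = j.
Proof.
move=> v_inj [Igen Imin] le_v; apply/eqP/negPn/negP => ne_j.
pose G' : set {mpoly K[n]} := [set 'X_[v k] | k in [set k | k != j]].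
apply: (Imin G').
  split; first by move=> _ [k _ <-]; exists k.
  move=> /(_ 'X_[v j]) [|k /= kj]; first by exists j.
  move=> /(congr1 (fun p => p@_(v j))) /eqP; rewrite !mcoeffX eqxx.
  by rewrite (inj_eq v_inj) (negPf kj) eq_sym oner_eq0.
rewrite Igen; apply/seteqP; split; apply: ideal_gen_ind.
- exact: ideal_gen0.
- exact: ideal_genD.
- by move=> c _ [k _ <-]; apply: ideal_gen_mul; exists k.
- exact: ideal_gen0.
- exact: ideal_genD.
move=> c _ [k _ <-]; apply: ideal_genM.
have [->|kj] := eqVneq k j; last by apply: ideal_gen_sub; exists k.
by rewrite -(submK le_v) mpolyXD; apply: ideal_gen_mul; exists j'.
Qed.

(** A nonzero point of the orthant on all hyperplanes [A k] lies in the cone.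
    The generators which occur in an expression of it lie in the same
    hyperplanes, as they are on the nonnegative side.  If only unit vectors
    occurred, some [e_i] would be orthogonal to all [A k]; then
    [x^(v_j) / x_i] for some [v_j] involving [x_i] would give a point of the
    cone, hence be divisible by some [x^(v_j')], the monomials being
    square-free.  This contradicts the incomparability of the [v_j]. *)
Lemma exists_generator_on_hyperplanes (R : realType) (n q r : nat)
    (v : 'I_q -> 'X_{1..n}) (A : 'I_r -> 'rV[R]_(n + 1))
    (alpha : 'rV[R]_(n + 1)) :
  (forall u, rees_cone R v u <->
     (forall i, 0 <= u 0 i) /\ (forall k, 0 <= dotv u (A k))) ->
  (forall j j', (v j' <= v j)%MM -> j' = j) ->
  (forall j i, v j i <= 1)%N ->
  (forall i, exists j, 0 < v j i)%N ->
  alpha <> 0 -> (forall i, 0 <= alpha 0 i) ->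
  (forall k, dotv alpha (A k) = 0) ->
  exists j, forall k, dotv (rees_point R (v j) 1) (A k) = 0.
Proof.
move=> coneE v_min v_sqf v_vars alpha0 alpha_ge0 alphaA.
have /rees_coneP[D [D0 sD Db]] : rees_cone R v alpha.
  by apply/coneE; split=> // k; rewrite alphaA.
have gen_ge0 j k : 0 <= dotv (rees_point R (v j) 1) (A k).
  have /(rees_exponent_cone R)/coneE[_] := rees_exponent_gen v j.
  exact.
have unit_ge0 i k : 0 <= dotv (delta_mx 0 (lshift 1 i)) (A k).
  have /coneE[_] : rees_cone R v (delta_mx 0 (lshift 1 i)).
    by rewrite -[delta_mx _ _]scale1r; apply: cone_gen => //; left; exists i.
  exact.
pose s i := alpha 0 (lshift 1 i) - \sum_j D j * (v j i)%:R.
have s0 i : 0 <= s i by rewrite subr_ge0.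
have zero k : (forall j, D j * dotv (rees_point R (v j) 1) (A k) = 0) /\
    (forall i, s i * dotv (delta_mx 0 (lshift 1 i)) (A k) = 0).
  have := alphaA k; rewrite (rees_slack_decomposition v sD : alpha =
    _ + \sum_i s i *: _) dotvDl.
  rewrite !dotv_suml => /eqP; rewrite paddr_eq0; last 2 first.
  - by apply: sumr_ge0 => j _; rewrite dotvZl; apply: mulr_ge0.
  - by apply: sumr_ge0 => i _; rewrite dotvZl; apply: mulr_ge0.
  case/andP; rewrite !psumr_eq0; last 2 first.
  - by move=> i _; rewrite dotvZl; apply: mulr_ge0.
  - by move=> j _; rewrite dotvZl; apply: mulr_ge0.
  move=> /allP H1 /allP H2; split=> i; rewrite -dotvZl; apply/eqP.
    by have := H1 i; rewrite mem_index_enum => /(_ isT).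
  by have := H2 i; rewrite mem_index_enum => /(_ isT).
have [[j Dj]|noD] := pselect (exists j, D j != 0).
  exists j => k; have [/(_ j) /eqP H _] := zero k; move: H.
  by rewrite mulf_eq0 (negPf Dj) => /eqP.
have D_0 j : D j = 0 by apply/eqP/negPn/negP => Dj; apply: noD; exists j.
have [i si] : exists i, s i != 0.
  apply: contrapT => nos; apply: alpha0; apply/rowP => i; rewrite mxE.
  case: (split_ordP i) => i' ->; last first.
    by rewrite ord1 -sD big1 // => j _; apply: D_0.
  have -> : alpha 0 (lshift 1 i') = s i'.
    by rewrite /s big1 ?subr0 // => j _; rewrite D_0 mul0r.
  by apply/eqP/negPn/negP => si; apply: nos; exists i'.
have iA k : dotv (delta_mx 0 (lshift 1 i)) (A k) = 0.
  have [_ /(_ i) /eqP] := zero k.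
  by rewrite mulf_eq0 (negPf si) => /eqP.
have [j vji] := v_vars i; exfalso.
pose b := (v j - U_(i))%MM.
have vjE : v j = (b + U_(i))%MM.
  by rewrite submK // lep1mP -lt0n.
have ptE : rees_point R (v j) 1 = rees_point R b 1 + delta_mx 0 (lshift 1 i).
  apply/rowP => i'; rewrite [RHS]mxE; case: (split_ordP i') => k ->.
    rewrite !rees_point_l vjE mnmDE natrD mnm1E mxE eqxx eq_lshift.
    by rewrite (eq_sym k).
  by rewrite !rees_point_r mxE eqxx eq_rlshift addr0.
have /rees_coneP[E [E0 sE Eb]] : rees_cone R v (rees_point R b 1).
  apply/coneE; split=> [i'|k].
    by case: (split_ordP i') => k ->; rewrite ?rees_point_l ?rees_point_r ler0n.
  by have := gen_ge0 j k; rewrite ptE dotvDl iA addr0.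
have [j' Ej'] : exists j', E j' != 0.
  apply: contrapT => noE; move: sE; rewrite rees_point_r big1.
    by move/eqP; rewrite eq_sym oner_eq0.
  by move=> j' _; apply/eqP/negPn/negP => Ej'; apply: noE; exists j'.
have le_b : (v j' <= b)%MM.
  apply/mnm_lepP => i'; have [vi0|] := posnP (v j' i'); first by rewrite vi0.
  move=> vi0; apply: leq_trans (v_sqf j' i') _; rewrite -(ltr0n R).
  have := Eb i'; rewrite rees_point_l; apply: lt_le_trans.
  rewrite (bigD1 j') //= ltr_wpDr ?sumr_ge0 //.
    by move=> k _; apply: mulr_ge0.
  by rewrite mulr_gt0 ?ltr0n // lt_def Ej' E0.
have jj : j' = j by apply: v_min; apply: lepm_trans le_b (lem_subr _ _).
by move/mnm_lepP/(_ i): le_b; rewrite jj mnmBE mnm1E eqxx; lia.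
Qed.

(** * Contraction to the monomials without a given variable *)

Definition drop_exp n (i : 'I_n) (m : 'X_{1..n}) : 'X_{1..n.-1} :=
  [multinom m (lift i j) | j < n.-1].

Lemma drop_var_inclX (K : fieldType) n (i : 'I_n) (m : 'X_{1..n}) :
  m i = 0%N -> drop_var_incl i 'X_[drop_exp i m] = 'X_[m] :> {mpoly K[n]}.
Proof.
move=> mi; rewrite /drop_var_incl comp_mpolyX [RHS]mpolyXE_id.
rewrite (bigD1_ord i) //= mi expr0 mul1r; apply: eq_bigr => j _.
by rewrite tnth_mktuple mnmE.
Qed.

(** Generators involving [x_i] cannot divide a power of [x^b], so [x^(bN)] lies
    in the [(N c)]-th power of the contraction and [x^b] is integral over
    its [c]-th power. *)
Lemma monomial_pow_of_contraction (K : fieldType) (n q : nat)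
    (v : 'I_q -> 'X_{1..n}) (I : set {mpoly K[n]}) (i : 'I_n)
    (b : 'X_{1..n}) c N :
  (forall j, I 'X_[v j]) -> normal_ideal (contract_var i I) ->
  (0 < c)%N -> (0 < N)%N -> b i = 0%N ->
  rees_exponent v (b *+ N)%MM (N * c) -> ideal_pow I c 'X_[b].
Proof.
move=> Iv In c0 N0 bi [w wc wb].
have wv j : (0 < w j)%N -> v j i = 0%N.
  have := wb i; rewrite mulmnE bi mul0n leqn0 sum_nat_eq0 => /forallP/(_ j).
  by rewrite muln_eq0 => /orP[/eqP->|/eqP].
rewrite -(drop_var_inclX K bi).
apply: (@ideal_pow_rmorph _ _ (comp_mpoly _ : {rmorphism _ -> _})
  (contract_var i I)) => //.
rewrite In //; apply: (integral_closure_root N0); rewrite mpolyXn -wc.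
apply: (@monomial_ideal_pow _ _ _ _ (fun j => drop_exp i (v j)))
  => [j /wv vj|k].
  by rewrite /contract_var /preimage /= drop_var_inclX.
rewrite mulmnE mnmE; have := wb (lift i k); rewrite mulmnE.
by under [X in _ -> (X <= _)%N]eq_bigr => j _ do rewrite mnmE.
Qed.

(** Induction on the degree [c] in [t].  If [x^(v_j0)] divides [x^b], then
    subtracting [(v_j0, 1)] does not leave the cone, because this vector lies in
    all the hyperplanes [A k].  Otherwise a variable of [x^(v_j0)] does not
    occur in [x^b], the generators being square-free, and the contraction
    to the other variables is normal. *)
Lemma rees_cone_exponent (R : realType) (K : fieldType) (n q r : nat)
    (v : 'I_q -> 'X_{1..n}) (I : set {mpoly K[n]})
    (A : 'I_r -> 'rV[R]_(n + 1)) (j0 : 'I_q) b c :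
  (forall u, rees_cone R v u <->
     (forall i, 0 <= u 0 i) /\ (forall k, 0 <= dotv u (A k))) ->
  I = ideal_gen [set 'X_[v j] | j in [set: 'I_q]] ->
  (forall i, v j0 i <= 1)%N ->
  (forall k, dotv (rees_point R (v j0) 1) (A k) = 0) ->
  (forall i, normal_ideal (contract_var i I)) ->
  rees_cone R v (rees_point R b c) -> rees_exponent v b c.
Proof.
move=> coneE Igen v_sqf j0A In; elim: c b => [|c IH] b Hb.
  exact: rees_exponent0.
have [le_v|/existsNP[i /negP]] := pselect (forall i, v j0 i <= b i)%N.
  have {}le_v : (v j0 <= b)%MM by apply/mnm_lepP.
  move: Hb; rewrite -(submK le_v) -addn1 => Hb.
  apply: rees_exponentD; last exact: rees_exponent_gen.
  apply: IH; apply/coneE; split=> [i|k].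
    by case: (split_ordP i) => k ->; rewrite ?rees_point_l ?rees_point_r ler0n.
  move/coneE: Hb => [_ /(_ k)]; rewrite rees_pointD dotvDl j0A.
  by rewrite addr0.
rewrite -ltnNge => lt_b.
have bi : b i = 0%N by have := v_sqf i; lia.
have [N N0 HN] := rees_cone_multiple Hb.
apply: (ideal_pow_supp Igen (p := 'X_[b])); last by rewrite msuppX inE.
apply: (monomial_pow_of_contraction _ (In i)) bi HN => // j.
by rewrite Igen; apply: ideal_gen_sub; exists j.
Qed.

(** * Integral elements are almost integral *)

(** With [m] the degree of [p], the denominator is [y ^+ m]: the powers of
    [x / y] below the [m]-th are cleared by it, and the equation
    [p (x / y) = 0] expresses each higher power by lower ones with coefficients
    in [S]. *)
Lemma integral_common_denominator (A : idomainType) (S : set A) (x y : A)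
    (p : {poly A}) :
  S 0 -> S 1 -> (forall a b, S a -> S b -> S (a + b)) ->
  (forall a, S a -> S (- a)) -> (forall a b, S a -> S b -> S (a * b)) ->
  S x -> S y -> y != 0 -> p \is monic -> (forall i, S p`_i) ->
  root (map_poly (@tofrac A) p) (tofrac x / tofrac y) ->
  forall k, exists2 s, S s & y ^+ (size p).-1 * x ^+ k = s * y ^+ k.
Proof.
move=> S0 S1 SD SN SM Sx Sy y0 pmon pS proot.
have SX a k : S a -> S (a ^+ k).
  by move=> Sa; elim: k => // k IH; rewrite exprS; apply: SM.
set m := (size p).-1.
have sp : size p = m.+1.
  by rewrite prednK // size_poly_gt0 monic_neq0.
have relation : x ^+ m = - \sum_(i < m) p`_i * x ^+ i * y ^+ (m - i).
  have cancel (F : fieldType) (t u w z : F) : z != 0 ->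
    t * u * w = w * z * (t * (u / z)) by move=> z0; field.
  have fy0 : tofrac y != 0 by rewrite tofrac_eq0.
  apply/eqP; rewrite -addr_eq0 -tofrac_eq tofrac0 rmorphD rmorph_sum /=.
  move: proot; rewrite /root horner_coef.
  rewrite size_map_inj_poly ?tofrac0 //; last first.
    by move=> u w /eqP; rewrite tofrac_eq => /eqP.
  rewrite sp big_ord_recr /=.
  have pm : p`_m = 1 by rewrite -[RHS](monicP pmon) lead_coefE.
  rewrite !coef_map /= pm tofrac1 mul1r => /eqP H.
  have := congr1 ( *%R (tofrac y ^+ m)) H; rewrite mulr0 mulrDr => {}H.
  apply/eqP; apply: etrans H; rewrite [LHS]addrC; congr (_ + _).
    rewrite mulr_sumr; apply: eq_bigr => i _.
    rewrite !rmorphM !rmorphXn /= coef_map /= expr_div_n.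
    have -> : tofrac y ^+ m = tofrac y ^+ (m - i) * tofrac y ^+ i.
      by rewrite -exprD subnK // ltnW.
    by apply: cancel; rewrite expf_neq0.
  by rewrite rmorphXn expr_div_n mulrC divfK ?expf_neq0.
elim/ltn_ind => k IH; have [km|mk] := ltnP k m.
  exists (y ^+ (m - k) * x ^+ k); first by apply: SM; apply: SX.
  by rewrite mulrAC -exprD subnK // ltnW.
have /choice[s sE] (i : 'I_m) : exists s, S s /\
    y ^+ m * x ^+ (k - m + i) = s * y ^+ (k - m + i).
  have [|s] := IH (k - m + i)%N; last by exists s.
  by have := ltn_ord i; lia.
exists (- \sum_(i < m) p`_i * s i).
  apply: SN; apply: big_ind => // i _; apply: SM => //.
  by have [] := sE i.
rewrite -{1}(subnK mk) exprD relation !mulrN mulNr; congr (- _).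
rewrite !mulr_sumr mulr_suml; apply: eq_bigr => i _.
have [_ e] := sE i.
transitivity (p`_i * (y ^+ m * x ^+ (k - m + i)) * y ^+ (m - i)).
  by rewrite exprD; ring.
rewrite e -!mulrA -exprD; do 2!congr (_ * _); congr (_ ^+ _).
by have := ltn_ord i; lia.
Qed.

(** * Normality of the Rees algebra *)

Theorem proposition4p33
  (R : realType) (K : fieldType) (n : nat)
  (I : set {mpoly K[n]}) (g : nat)
  (I_height : ideal_height I g) (g_ge2 : (2 <= g)%N)
  (q : nat) (v : 'I_q -> 'X_{1..n}) (v_inj : injective v)
  (I_mingen : minimally_generated_by I [set 'X_[v j] | j in [set: 'I_q]])
  (v_sqfree : forall (j : 'I_q) (i : 'I_n), (v j i <= 1)%N)
  (v_deg : forall j : 'I_q, (2 <= mdeg (v j))%N)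
  (v_vars : forall i : 'I_n, exists j : 'I_q, (0 < v j i)%N)
  (r : nat) (a : 'I_r -> 'rV[rat]_(n + 1))
  (a_last : forall k : 'I_r, dotv (a k) (delta_mx 0 (rshift n ord0)) = -1)
  (a_repr : irreducible_representation (rees_cone R v) (rees_normals R a))
  (d : 'I_r -> nat) (l : 'I_r -> 'rV[int]_(n + 1))
  (d_gt0 : forall k : 'I_r, (0 < d k)%N)
  (l_def : forall k : 'I_r, map_mx intr (l k) = (d k)%:R *: a k)
  (l_prim : forall k : 'I_r, primitive_vec (l k))
  (Ii_normal : forall i : 'I_n, normal_ideal (contract_var i I))
  (H_nontrivial :
     (\bigcap_(k in [set: 'I_r]) hyperplane (map_mx intr (l k)))
       `&` orthant R (n + 1) <> [set 0]) :
  normal_domain (rees_algebra I).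
Proof.
have [Igen _] := I_mingen; have [coneE _] := a_repr.
pose A k : 'rV[R]_(n + 1) := map_mx ratr (a k).
have coneP u : rees_cone R v u <->
    (forall i, 0 <= u 0 i) /\ (forall k, 0 <= dotv u (A k)).
  rewrite coneE; split=> [H|[H1 H2] [i|k] _ /=].
  - split=> [i|k]; last exact: (H (inr k)).
    by have := H (inl i) Logic.I; rewrite /halfspace /= dotv_delta.
  - by rewrite /halfspace /= dotv_delta.
  - exact: H2.
have [alpha [alphaA alpha_ge0] alpha0] : exists2 alpha : 'rV[R]_(n + 1),
    (forall k, dotv alpha (A k) = 0) /\ (forall i, 0 <= alpha 0 i) & alpha <> 0.
  apply: contrapT => none; apply: H_nontrivial; apply/seteqP; split=> u /=.
    move=> [ul u_ge0]; apply: contrapT => u0; apply: none; exists u => //.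
    split=> // k; have := ul k Logic.I; rewrite /hyperplane /=.
    have -> : map_mx intr (l k) = (d k)%:R *: A k.
      apply/rowP => i; have /rowP/(_ i) := l_def k.
      by rewrite !mxE => e; rewrite -[LHS]ratr_int e rmorphM /= ratr_nat.
    rewrite /dotv; under eq_bigr => i _ do rewrite mxE mulrCA.
    rewrite -mulr_sumr => /eqP.
    by rewrite mulf_eq0 pnatr_eq0 gtn_eqF // => /eqP.
  move=> ->; split=> [k _|i]; last by rewrite mxE.
  by rewrite /hyperplane /= /dotv big1 // => i _; rewrite mxE mul0r.
have [j0 j0A] := exists_generator_on_hyperplanes coneP
  (fun j j' => mingen_antichain v_inj I_mingen) v_sqfree v_vars
  alpha0 alpha_ge0 alphaA.
have exponentP b c : rees_cone R v (rees_point R b c) -> rees_exponent v b c.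
  exact: rees_cone_exponent coneP Igen (v_sqfree j0) j0A Ii_normal.
move=> z [x [y [Sx Sy y0 zE]]] [p [pmon pS proot]].
have S0 : rees_algebra I 0 by move=> k; rewrite coef0; apply: ideal_gen0.
have S1 : rees_algebra I 1.
  by have := rees_algebra_monom (ideal_pow0 I 1); rewrite expr0 scale1r.
have SX k : rees_algebra I (y ^+ k).
  by elim: k => // k IH; rewrite exprS; apply: rees_algebraM.
rewrite zE in proot.
have almost := integral_common_denominator S0 S1 (@rees_algebraD _ I)
  (@rees_algebraN _ I) (@rees_algebraM _ I) Sx Sy y0 pmon pS proot.
have [s Ss xE] : exists2 s, rees_algebra I s & x = s * y.
  apply: (@division_almost_integral K n _ (rees_exponent v) _ x y S0
    (@rees_algebraD _ I) (@rees_algebraN _ I) (@rees_algebraM _ I)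
    _ _ _ _ y0 almost).
  - move=> s Ss s0; apply: ideal_pow_supp Igen (Ss _) _.
    by rewrite -lead_coefE mlead_supp // lead_coef_eq0.
  - move=> e b c [w <- wb]; apply: rees_algebra_monom.
    rewrite -mul_mpolyC; apply: ideal_genM.
    apply: monomial_ideal_pow wb => j _.
    by rewrite Igen; apply: ideal_gen_sub; exists j.
  - move=> b0 c0 b c H; apply: exponentP.
    exact: rees_cone_saturated coneE H.
  - by rewrite expf_neq0.
exists s => //; rewrite zE xE rmorphM /= mulfK //.
by rewrite tofrac_eq0.
Qed.
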